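(* Let $G$ be a $\sigma$-pro-$p$-group. The product map induces homeomorphisms $$G^+\times G^-\longrightarrow G,\ (a,b)\mapsto ab,\qquad\text{and}\qquad G^-\times G^+\longrightarrow G,\ (a,b)\mapsto ab.$$
   Context: Fix a prime $p>2$ and a group $\{1,\sigma\}$ of order $2$. A $\sigma$-pro-$p$-group is a pro-$p$-group $G$ with a continuous action of $\{1,\sigma\}$ by automorphisms, written $a\mapsto{}^\sigma a$. Put $G^+:=\{a\in G\mid{}^\sigma a=a\}$ and $G^-:=\{a\in G\mid{}^\sigma a=a^{-1}\}$, both with the subspace topology. *)

(* Defs.v *)
From HB Require Import structures.
From mathcomp Require Import all_boot.
From mathcomp Require Import boolp classical_sets functions cardinality filter.
From mathcomp Require Import topology.

Set Implicit Arguments.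
Unset Strict Implicit.
Unset Printing Implicit Defensive.

Local Open Scope classical_set_scope.
Local Open Scope group_scope.

HB.structure Definition PreTopologicalGroup := {G of Topological G & Group G}.

HB.mixin Record PreTopologicalGroup_isTopologicalGroup G
    & PreTopologicalGroup G := {
  mulg_continuous : continuous (fun x : G * G => x.1 * x.2) ;
  invg_continuous : continuous (fun x : G => x^-1)
}.

#[short(type="topologicalGroupType")]
HB.structure Definition TopologicalGroup :=
  {G of PreTopologicalGroup G & PreTopologicalGroup_isTopologicalGroup G}.

Definition subgroup (G : groupType) (H : set G) : Prop :=
  group_closed (mem H).

Definition normal_subgroup (G : groupType) (N : set G) : Prop :=
  subgroup N /\ forall x y : G, N x -> N (x ^ y).

Definition lcosets (G : groupType) (H : set G) : set (set G) :=
  [set (fun h => x * h) @` H | x in [set: G]].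

(* The definition of Dixon, du Sautoy, Mann and Segal (Analytic pro-p groups):
   a profinite group is a compact Hausdorff topological group in which the open
   subgroups form a base of neighbourhoods of 1. *)
Definition profinite_group (G : topologicalGroupType) : Prop :=
  [/\ compact [set: G],
      hausdorff_space G
    & forall U : set G, nbhs (1 : G) U ->
        exists H : set G, [/\ subgroup H, open H & H `<=` U]].

(* Same source: every open normal subgroup has index a power of p. *)
Definition pro_p_group (p : nat) (G : topologicalGroupType) : Prop :=
  profinite_group G /\
  forall N : set G, normal_subgroup N -> open N ->
    exists n : nat, (lcosets N #= `I_(p ^ n)%N)%card.

Definition continuous_action_by_automorphisms (C G : topologicalGroupType)
    (act : C -> G -> G) : Prop :=
  [/\ forall a : G, act 1 a = a,
      forall (c d : C) (a : G), act (c * d) a = act c (act d a),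
      forall c : C, {morph act c : a b / a * b}
    & continuous (fun ca : C * G => act ca.1 ca.2)].

(* {1, sigma} carries the discrete topology, as any finite topological group
   does by convention. *)
Definition is_group_of_order2 (C : topologicalGroupType) (sigma : C) : Prop :=
  [/\ sigma <> 1, [set: C] = [set 1; sigma] & forall A : set C, open A].

Definition sigma_pro_p_group (p : nat) (C : topologicalGroupType) (sigma : C)
    (G : topologicalGroupType) (act : C -> G -> G) : Prop :=
  [/\ is_group_of_order2 sigma,
      pro_p_group p G
    & continuous_action_by_automorphisms act].

Definition plus_part (G : groupType) (s : G -> G) : set G :=
  [set a | s a = a].

Definition minus_part (G : groupType) (s : G -> G) : set G :=
  [set a | s a = a^-1].

Definition homeomorphism (X Y : topologicalType) (f : X -> Y) : Prop :=
  continuous f /\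
  exists g : Y -> X, [/\ cancel f g, cancel g f & continuous g].

(* A set seen as a type is its set_type, with the subspace topology. *)
Definition mul_sub (G : topologicalGroupType) (A B : set G) (ab : A * B) : G :=
  set_val ab.1 * set_val ab.2.

(* Main.v *)
(** In a pro-p group with p odd every element has a unique square root, and the
    square root is continuous by compactness: modulo an open normal subgroup of
    index p^n the root of y is y^((p^n + 1)/2).  If g = a b with a fixed and b
    inverted by s := sigma, then s(g)^-1 g = b^2, so b is the square root of
    s(g)^-1 g and a = g b^-1; conversely these formulas give a decomposition,
    because s inverts s(g)^-1 g, hence also its square root.  For g = b a one
    uses g s(g)^-1 = b^2 instead. *)

Require Import Defs.
From mathcomp Require Import all_boot.
From mathcomp Require Import boolp classical_sets functions cardinality.
From mathcomp Require Import topology.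

Set Implicit Arguments.
Unset Strict Implicit.
Unset Printing Implicit Defensive.

Local Open Scope classical_set_scope.
Local Open Scope group_scope.

(** * Counting cosets: powers that land in a normal subgroup *)

(** All cycles of [f] have the same length, so this length divides [#|T|]. *)
Lemma iter_card_semiregular (T : finType) (f : T -> T) :
    injective f ->
    (forall k x y, iter k f x = x -> iter k f y = y) ->
  forall x, iter #|T| f x = x.
Proof.
move=> f_inj f_semireg x.
(* The iterate of index [order f z] fixes [z], hence also [y], so the cycle of [y] cannot be
   longer. *)
have order_le y z : fingraph.order f y <= fingraph.order f z.
  rewrite leqNgt; apply/negP => /findex_iter.
  rewrite (f_semireg _ _ _ (iter_order f_inj z)) findex0.
  by move=> /esym/eqP; rewrite -leqn0 leqNgt order_gt0.
have f_closed : fclosed f T by [].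
have T_order : T \subset order_set f (fingraph.order f x).
  by apply/fintype.subsetP => y _; rewrite inE eqn_leq !order_le.
rewrite -(fcard_order_set f_inj T_order f_closed).
by elim: (fcard _ _) => // k IHk; rewrite mulSn iterD IHk iter_order.
Qed.

Section Subgroups.
Context {G : groupType} {H : set G} (subH : subgroup H).

Lemma subgroup1 : H 1.
Proof. by case: subH => /set_mem. Qed.

Lemma subgroup_div x y : H x -> H y -> H (x / y).
Proof. by case: subH => _ subHV Hx Hy; apply/set_mem/subHV; exact/mem_set. Qed.

Lemma subgroupV x : H x -> H x^-1.
Proof. by rewrite -div1g; apply: subgroup_div; exact: subgroup1. Qed.

Lemma subgroupM x y : H x -> H y -> H (x * y).
Proof. by move=> Hx /subgroupV Hy; rewrite -[y]invgK; exact: subgroup_div. Qed.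

Lemma lcoset_eqP x y :
  [set x * h | h in H] = [set y * h | h in H] <-> H (x^-1 * y).
Proof.
split=> [xHyH|Hxy].
  have: [set y * h | h in H] (y * 1) by exists 1 => //; exact: subgroup1.
  by rewrite -xHyH => -[h Hh]; rewrite mulg1 => <-; rewrite mulKg.
apply/seteqP; split=> _ [h Hh <-].
  exists ((x^-1 * y)^-1 * h); first exact: subgroupM (subgroupV Hxy) Hh.
  by rewrite invgM invgK !mulgA mulgV mul1g.
exists (x^-1 * y * h); first exact: subgroupM.
by rewrite !mulgA mulgV mul1g.
Qed.

End Subgroups.

(* Left translation by [x] on the [m] cosets of [N] is semiregular because
   [N] is normal. *)
Lemma expg_index (G : groupType) (N : set G) (m : nat) (x : G) :
  normal_subgroup N -> (lcosets N #= `I_m)%card -> N (x ^+ m).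
Proof.
move=> [subN nN] /card_set_bijP[c [c_fun c_inj c_surj]].
pose lN (a : G) := [set a * h | h in N].
have lNP a : lcosets N (lN a) by exists a.
pose idx a : 'I_m := Ordinal (c_fun _ (lNP a)).
have idxP a b : idx a = idx b <-> N (a^-1 * b).
  rewrite -(lcoset_eqP subN) -/(lN a) -/(lN b); split=> [[]|ab].
    by apply: c_inj; rewrite inE; exact: lNP.
  by apply: val_inj; rewrite /= ab.
have /choice[r rK] (k : 'I_m) : exists a, idx a = k.
  have [_ [a _ <-] ca] := c_surj k (ltn_ord k).
  by exists a; apply: val_inj.
pose f k := idx (x * r k).
have fE a : f (idx a) = idx (x * a).
  by apply/idxP; rewrite invgM divgKA; apply/idxP; rewrite rK.
have iterE k a : iter k f (idx a) = idx (x ^+ k * a).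
  by elim: k => [|k IHk]; rewrite ?mul1g //= IHk fE expgS mulgA.
(* The power [x ^+ k] fixes the coset of [r j] iff its conjugate by [r j] lies in [N]. By normality
   this does not depend on [j], which is the semiregularity of [f]. *)
have fixP k j : iter k f j = j <-> N (x ^+ k).
  rewrite -[j]rK iterE; split=> [/esym/idxP/(nN _ (r j)^-1)|Nx].
    by rewrite conjgE invgK !mulgA mulgV mul1g mulgK.
  by apply/esym/idxP; rewrite -conjgE; exact: nN.
have f_inj : injective f.
  move=> j k; rewrite -[j]rK -[k]rK !fE => /idxP.
  by rewrite invgM divgKA => /idxP.
have := iter_card_semiregular f_inj.
rewrite card_ord => f_iter; apply/(fixP m (idx 1))/f_iter => k i j.
by move=> /fixP/fixP.
Qed.

(** * Open subgroups and normal cores *)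

Section TopologicalGroups.
Context {G : topologicalGroupType}.

Lemma continuous_mulg (T : topologicalType) (f g : T -> G) :
  continuous f -> continuous g -> continuous (fun x => f x * g x).
Proof.
move=> fc gc x; have mc := @mulg_continuous G (f x, g x).
apply: (continuous_comp (f := fun x => (f x, g x))) mc.
exact: cvg_pair (fc x) (gc x).
Qed.

Lemma continuous_invg (T : topologicalType) (f : T -> G) :
  continuous f -> continuous (fun x => (f x)^-1).
Proof.
by move=> fc x; apply: continuous_comp; [exact: fc|exact: invg_continuous].
Qed.

Lemma nbhs_lmul (a b : G) (U : set G) :
  nbhs (a * b) U -> nbhs b [set z | U (a * z)].
Proof.
apply: (continuous_mulg (f := fun=> a) (g := id)) => x.
  exact: cvg_cst.
exact: cvg_id.
Qed.

Lemma open_subgroup (H : set G) : subgroup H -> nbhs (1 : G) H -> open H.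
Proof.
move=> subH H1; rewrite openE => x Hx; rewrite /interior.
move: H1; rewrite -(mulVg x) => /nbhs_lmul; apply: filterS => y /= Hxy.
by rewrite -(mulVKg x y); exact: (subgroupM subH).
Qed.

(* The normal core of an open subgroup is open, by compactness of the group
   of conjugating elements. *)
Lemma profinite_open_normal (U : set G) :
  profinite_group G -> nbhs (1 : G) U ->
  exists N : set G, [/\ normal_subgroup N, open N & N `<=` U].
Proof.
move=> [Gcompact _ Gbase] /Gbase[H [subH Hopen HU]].
pose N : set G := [set x | forall y, H (x ^ y)].
have subN : subgroup N.
  split=> [|x y /set_mem Nx /set_mem Ny]; apply/mem_set => z.
    by rewrite conj1g; exact: subgroup1.
  by rewrite conjMg conjVg; exact: subgroup_div.
exists N; split.
- by split=> // x y Nx z; rewrite -conjgM.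
- apply: (open_subgroup subN).
  (* Conjugation is jointly continuous and sends [(x, 1)] to 1, which lies in the open set [H]. *)
  have conj_near (x : G) : [set: G] x ->
      \forall x' \near x & i \near (1 : G), H (i ^ x').
    move=> _.
    have conjc : continuous (fun u : G * G => u.1^-1 * (u.2 * u.1)).
      apply: continuous_mulg.
        by apply: continuous_invg => -[a b]; exact: cvg_fst.
      by apply: continuous_mulg => -[a b]; [exact: cvg_snd|exact: cvg_fst].
    apply: (conjc (x, 1)) => /=; rewrite mul1g mulVg.
    by apply: open_nbhs_nbhs; split=> //; exact: subgroup1.
  (* Compactness turns these local statements into one neighbourhood of 1 whose conjugates by all
     elements lie in [H]. *)
  have /compact_near_coveringP Gcover := Gcompact.
  have Nnbhs := Gcover _ _ (fun i x => H (i ^ x)) (nbhs_filter _) conj_near.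
  by apply: filterS Nnbhs => z Nz y; exact: Nz.
- by move=> x /(_ 1); rewrite conjg1 => /HU.
Qed.

End TopologicalGroups.

(** The preimage of a closed set under [g] is its image under [f], which is compact and hence
    closed. *)
Lemma compact_hausdorff_inverse_continuous (X Y : topologicalType)
    (f : X -> Y) (g : Y -> X) :
  compact [set: X] -> hausdorff_space Y -> continuous f ->
  cancel f g -> cancel g f -> continuous g.
Proof.
move=> Xc Yh fc fK gK; apply/continuous_closedP => A Acl.
have -> : g @^-1` A = f @` A.
  by apply/seteqP; split=> [y Agy|_ [x Ax <-] /=]; [exists (g y)|rewrite fK].
apply: compact_closed => //; apply: continuous_compact.
  exact: continuous_subspaceT.
exact: subclosed_compact Acl Xc _.
Qed.

(** * Square roots in pro-p groups for odd p *)

Section SquareRoot.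
Context {p : nat} {G : topologicalGroupType}.
Hypotheses (p_odd : odd p) (Gp : pro_p_group p G).

(** Modulo a small open normal subgroup, squaring is inverted by a fixed power [r]: the error term
    [z] is [x ^+ (p ^ n)], where [p ^ n] is the index. *)
Lemma pro_p_open_normal (U : set G) : nbhs (1 : G) U ->
  exists (N : set G) (r : nat), [/\ subgroup N, N `<=` U
    & forall x, exists2 z, N z & (x * x) ^+ r = x * z].
Proof.
case: Gp => Gprof Gindex /(profinite_open_normal Gprof)[N [nN oN NU]].
have [n Nindex] := Gindex N nN oN.
(* As [p ^ n] is odd, twice [uphalf (p ^ n)] is [p ^ n + 1]. *)
exists N, (uphalf (p ^ n)); split=> [||x]; [by case: nN|by []|].
exists (x ^+ (p ^ n)); first exact: expg_index.
rewrite -expg2 -expgnA mul2n uphalfE -expgS even_halfK //=.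
by rewrite negbK oddX p_odd orbT.
Qed.

Lemma continuous_sqrg : continuous (fun x : G => x * x).
Proof. by apply: continuous_mulg => x; exact: cvg_id. Qed.

Lemma pro_p_sqrg_inj : injective (fun x : G => x * x).
Proof.
move=> x y /= xxyy; apply: contrapT => xy.
have [[_ Ghaus _] _] := Gp.
(* Choose [N] so small that the coset [y N] misses [x]; equal squares give [x * a = y * b] with [a],
   [b] in [N], which puts [x] in [y N]. *)
have /(nbhs_lmul (a := y)) : nbhs (y * 1) (~` [set x]).
  rewrite mulg1; apply: open_nbhs_nbhs; split; last by move=> /esym.
  rewrite openC; apply: accessible_closed_set1.
  exact: hausdorff_accessible.
move=> /pro_p_open_normal[N [r [subN NU sqN]]].
have [[a Na xa] [b Nb yb]] := (sqN x, sqN y).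
apply: (NU (b / a)) => /=; first exact: subgroup_div.
by rewrite mulgA -yb -xxyy xa mulgK.
Qed.

Lemma pro_p_sqrg_surj (x : G) : exists y, y * y = x.
Proof.
have [[Gcompact Ghaus _] _] := Gp.
pose S : set G := range (fun y : G => y * y).
have Sclosed : closed S.
  apply: compact_closed => //; apply: continuous_compact => //.
  exact/continuous_subspaceT/continuous_sqrg.
suff: S x by case=> y _; exists y.
(* Otherwise some coset [x N] misses the closed set [S], yet it contains [(x * x) ^+ r], the square
   of [x ^+ r]. *)
apply: contrapT => NSx.
have /(nbhs_lmul (a := x)) : nbhs (x * 1) (~` S).
  by rewrite mulg1; apply: open_nbhs_nbhs; split=> //; rewrite openC.
move=> /pro_p_open_normal[N [r [_ NU /(_ x)[z Nz xz]]]].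
apply: (NU z Nz); rewrite -xz; exists (x ^+ r) => //.
by rewrite expgMn.
Qed.

Lemma pro_p_sqrt : exists rt : G -> G,
  [/\ cancel (fun x => x * x) rt, cancel rt (fun x => x * x) & continuous rt].
Proof.
have [rt rtK] := choice pro_p_sqrg_surj.
have sqK : cancel (fun x => x * x) rt by move=> x; apply: pro_p_sqrg_inj.
exists rt; split=> //; have [[Gcompact Ghaus _] _] := Gp.
exact: compact_hausdorff_inverse_continuous continuous_sqrg sqK rtK.
Qed.

End SquareRoot.

(** Serves both orders of the factors: the inverse map is given by its two components, taken as maps
    from [G] to [G] so that subtypes are dealt with only here. *)
Lemma homeomorphism_mul_sub (G : topologicalGroupType) (A B : set G)
    (u v : G -> G) :
  continuous u -> continuous v -> (forall g, A (u g)) -> (forall g, B (v g)) ->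
  (forall g, u g * v g = g) ->
  (forall a b, A a -> B b -> u (a * b) = a /\ v (a * b) = b) ->
  homeomorphism (@mul_sub G A B).
Proof.
move=> uc vc Au Bv uvE abE; split.
  apply: continuous_mulg => -[a b].
    apply: (continuous_comp (f := fst) (g := set_val)); first exact: cvg_fst.
    exact: initial_continuous.
  apply: (continuous_comp (f := snd) (g := set_val)); first exact: cvg_snd.
  exact: initial_continuous.
pose u' g : A := SigSub (mem_set (Au g)).
pose v' g : B := SigSub (mem_set (Bv g)).
(* The subspace topology is initial for [set_val], so it suffices that the composite with [set_val]
   is continuous. *)
have u'c : continuous u' by apply: continuous_comp_initial; exact: uc.
have v'c : continuous v' by apply: continuous_comp_initial; exact: vc.
exists (fun g => (u' g, v' g)); split.
- move=> [a b]; have [ua vb] := abE _ _ (set_valP a) (set_valP b).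
  by congr pair; apply: val_inj.
- by move=> g; exact: uvE.
- by move=> g; exact: cvg_pair (u'c g) (v'c g).
Qed.

Theorem proposition4p2 (p : nat) (p_prime : prime p) (p_gt2 : (2 < p)%N)
    (C : topologicalGroupType) (sigma : C)
    (G : topologicalGroupType) (act : C -> G -> G)
    (hG : sigma_pro_p_group p sigma act) :
  homeomorphism (@mul_sub G (plus_part (act sigma)) (minus_part (act sigma))) /\
  homeomorphism (@mul_sub G (minus_part (act sigma)) (plus_part (act sigma))).
Proof.
case: hG => -[sigma_neq1 Csigma _] Gp [act1 actM act_morph act_cont].
have p_odd : odd p by case: (even_prime p_prime) => // p2; rewrite p2 in p_gt2.
have [rt [sqK rtK rtc]] := pro_p_sqrt p_odd Gp.
set s := act sigma.
have sM : {morph s : a b / a * b} := act_morph sigma.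
have sigma2 : sigma * sigma = 1.
  have: [set: C] (sigma * sigma) by [].
  rewrite Csigma => -[//|sigmaE]; case: sigma_neq1.
  by apply: (@mulgI _ sigma); rewrite sigmaE mulg1.
have sK a : s (s a) = a by rewrite /s -actM sigma2 act1.
have s1 : s 1 = 1 by apply: (@mulgI _ (s 1)); rewrite -sM !mulg1.
have sV a : s a^-1 = (s a)^-1.
  by apply/esym/mulg1_eq; rewrite -sM mulgV.
have sc : continuous s.
  move=> a; have actc := act_cont (sigma, a).
  apply: (continuous_comp (f := fun a => (sigma, a))) actc.
  by apply: cvg_pair; [exact: cvg_cst|exact: cvg_id].
have idc : continuous (@id G) by move=> x; exact: cvg_id.
(* Both sides square to [x^-1], and squaring is injective. *)
have s_rt x : s x = x^-1 -> s (rt x) = (rt x)^-1.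
  move=> sx; apply: (can_inj sqK); rewrite -sM rtK sx.
  by rewrite -invgM rtK.
split.
- pose v g := rt ((s g)^-1 * g).
  have sv g : s (v g) = (v g)^-1.
    by apply: s_rt; rewrite sM sV sK invgM invgK.
  have vv g : v g * v g = (s g)^-1 * g by rewrite rtK.
  have vc : continuous v.
    move=> g; apply: continuous_comp; last exact: rtc.
    by apply: continuous_mulg; first exact: continuous_invg.
  have v_mul a b : s a = a -> s b = b^-1 -> v (a * b) = b.
    by move=> sa sb; rewrite /v sM sa sb invgM invgK -mulgA mulKg sqK.
  apply: (homeomorphism_mul_sub (u := fun g => g / v g) (v := v)) => //.
  + by apply: continuous_mulg => //; exact: continuous_invg.
  (* The claim is now [s g * v g = g / v g]; multiplying by [v g] on the right leaves
     [s g * (v g * v g) = g]. *)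
  + move=> g; rewrite /plus_part /= sM sV sv invgK.
    by apply: (@mulIg _ (v g)); rewrite mulgVK -mulgA vv mulVKg.
  + by move=> g; rewrite mulgVK.
  + by move=> a b sa sb; rewrite v_mul // mulgK.
- pose v g := rt (g / s g).
  have sv g : s (v g) = (v g)^-1.
    by apply: s_rt; rewrite sM sV sK invgM invgK.
  have vv g : v g * v g = g / s g by rewrite rtK.
  have vc : continuous v.
    move=> g; apply: continuous_comp; last exact: rtc.
    by apply: continuous_mulg; last exact: continuous_invg.
  have v_mul b a : s b = b^-1 -> s a = a -> v (b * a) = b.
    by move=> sb sa; rewrite /v sM sa sb mulgKA invgK sqK.
  apply: (homeomorphism_mul_sub (u := v) (v := fun g => (v g)^-1 * g)) => //.
  + by apply: continuous_mulg => //; exact: continuous_invg.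
  (* Mirror image: multiplying by [v g] on the left leaves [v g * v g * s g = g]. *)
  + move=> g; rewrite /plus_part /= sM sV sv invgK.
    by apply: (@mulgI _ (v g)); rewrite mulVKg mulgA vv mulgVK.
  + by move=> g; rewrite mulVKg.
  + by move=> b a sb sa; rewrite v_mul // mulKg.
Qed.
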